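(* Let $\mathbf{k}$ be an arbitrary field and let $A$ be a finite-dimensional symmetrically self-dual Hopf algebra over $\mathbf{k}$ with basis $\{d_i\}_{i\in I}$ and structure constants $$d_i\cdot d_j=\sum_{k\in I}\widetilde F_{ij}^k\, d_k,\qquad \Delta(d_k)=\sum_{i,j\in I}\widetilde G_{ij}^k\, d_i\otimes d_j ,$$ and let $\varphi:A\to A^*$ be a Hopf algebra isomorphism with $\varphi=\varphi^*$, given by $\varphi(d_i)=\sum_{j\in I}s_{ji}\,d_j^*$ for all $i\in I$, where $\{d_i^*\}_{i\in I}$ is the dual basis. Let $A^\imath$ be the vector space with the same basis $\{d_i\}_{i\in I}$ as $A$, equipped with the bilinear multiplication $d_i\diamond d_j=\sum_{k\in I}{}^\imath\widetilde F_{ij}^k\, d_k$, where $${}^\imath\widetilde F_{ij}^k=\sum_{y_1,y_2,x,z\in I}s_{y_1y_2}\,\widetilde G_{y_1x}^{i}\,\widetilde G_{zy_2}^{j}\,\widetilde F_{xz}^{k}\qquad\text{for any } i,j,k\in I .$$ Then $(A^\imath,\diamond)$ is an associative algebra with unit $u(1)$, where $u:\mathbf{k}\to A$ is the unit map of $A$.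
   Context: For a finite-dimensional Hopf algebra $A$ with basis $\{d_i\}_{i\in I}$ and structure constants $\widetilde F_{ij}^k$ (multiplication), $\widetilde G_{ij}^k$ (comultiplication), the dual space $A^*$ with dual basis $\{d_i^*\}$ carries the dual Hopf algebra structure, with $d_i^*\cdot d_j^*=\sum_k\widetilde G_{ij}^k d_k^*$ and $\Delta(d_k^* )=\sum_{i,j}\widetilde F_{ij}^k\, d_i^*\otimes d_j^*$. $A$ is called self-dual if there is a Hopf algebra isomorphism $\varphi:A\to A^*$; it is called symmetrically self-dual if moreover $\varphi=\varphi^*$, where $\varphi^*:A\to A^*$ is defined by $\varphi^*(d_i)(d_j)=\varphi(d_j)(d_i)$ for all $i,j\in I$ (equivalently, the matrix $(s_{ij})$ is symmetric). *)

(* Defs.v *)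
From HB Require Import structures.
From mathcomp Require Import all_boot all_order all_algebra all_field.

Set Implicit Arguments.
Unset Strict Implicit.
Unset Printing Implicit Defensive.

Import GRing.Theory VectorInternalTheory.
Local Open Scope ring_scope.

(** * Tensor product of finite-dimensional vector spaces

    [tensor U V] is modelled by matrices of coordinates on the internal bases
    of [U] and [V], a pure tensor being a rank-one matrix; [tensor_lift] is the
    universal property (see [tensor_liftE]). *)

Notation bilin f := (bilinear_for *:%R *:%R f).

Section Tensor.
Variables (k : fieldType) (U V : vectType k).

Definition tensor : Type := 'M[k]_(dim U, dim V).
HB.instance Definition _ := Vector.on tensor.

Definition tens (u : U) (v : V) : tensor := (v2r u)^T *m v2r v.

Definition ibase (i : 'I_(dim U)) : U := r2v (delta_mx 0 i).

End Tensor.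

Arguments ibase {k} U i.
Notation "u ⊗ v" := (tens u v) (at level 39, left associativity) : ring_scope.

Section TensorLift.
Variables (k : fieldType) (U V W : vectType k).
Implicit Types (f : U -> V -> W) (t : tensor U V).

Definition tensor_lift f t : W :=
  \sum_i \sum_j (t i j : k) *: f (ibase U i) (ibase V j).

Fact tensor_lift_linear f : linear (tensor_lift f).
Proof.
move=> c t t'; rewrite /tensor_lift scaler_sumr -big_split /=.
apply: eq_bigr => i _; rewrite scaler_sumr -big_split /=; apply: eq_bigr => j _.
by rewrite !mxE scalerDl scalerA.
Qed.
HB.instance Definition _ f := GRing.isSemilinear.Build k (tensor U V) W _
  (tensor_lift f) (GRing.semilinear_linear (tensor_lift_linear f)).

Lemma eq_tensor_lift f g t :
  (forall u v, f u v = g u v) -> tensor_lift f t = tensor_lift g t.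
Proof. by move=> fg; do 2![apply: eq_bigr => ? _]; rewrite fg. Qed.

Lemma ibase_sum (u : U) : u = \sum_i (v2r u 0 i) *: ibase U i.
Proof.
apply: v2r_inj; rewrite linear_sum {1}[v2r u]row_sum_delta.
by apply: eq_bigr => i _; rewrite linearZ /= r2vK.
Qed.

End TensorLift.

Section TensorTheory.
Variable k : fieldType.

Lemma bilin_suml (U V W : vectType k) (f : U -> V -> W) (I : finType)
    (c : I -> k) (x : I -> U) v :
  bilin f -> f (\sum_i c i *: x i) v = \sum_i c i *: f (x i) v.
Proof.
case=> fl _; pose g := f^~ v.
pose gL : {linear U -> W} := HB.pack g (GRing.isLinear.Build k U W *:%R g (fl v)).
by rewrite -[LHS]/(gL _) linear_sum; apply: eq_bigr => i _; rewrite linearZ.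
Qed.

Lemma bilin_sumr (U V W : vectType k) (f : U -> V -> W) (I : finType)
    (c : I -> k) (x : I -> V) u :
  bilin f -> f u (\sum_i c i *: x i) = \sum_i c i *: f u (x i).
Proof.
case=> _ fr; pose g := f u.
pose gL : {linear V -> W} := HB.pack g (GRing.isLinear.Build k V W *:%R g (fr u)).
by rewrite -[LHS]/(gL _) linear_sum; apply: eq_bigr => i _; rewrite linearZ.
Qed.

Lemma tensor_liftE (U V W : vectType k) (f : U -> V -> W) u v :
  bilin f -> tensor_lift f (u ⊗ v) = f u v.
Proof.
move=> fB; rewrite [in RHS](ibase_sum u) bilin_suml //; apply: eq_bigr => i _.
rewrite [in RHS](ibase_sum v) bilin_sumr // scaler_sumr; apply: eq_bigr => j _.
by rewrite scalerA !mxE big_ord1 !mxE.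
Qed.

Lemma tens_bilin (U V : vectType k) : bilin (@tens k U V).
Proof.
split=> [v c u u'|u c v v']; rewrite /tens linearP.
  by rewrite linearP /= mulmxDl -scalemxAl.
by rewrite mulmxDr -scalemxAr.
Qed.

Lemma tens_ibase (U V : vectType k) i j :
  ibase U i ⊗ ibase V j = delta_mx i j.
Proof.
by rewrite /tens /ibase !r2vK trmx_delta mul_delta_mx.
Qed.

Lemma tensor_id (U V : vectType k) (t : tensor U V) : tensor_lift (@tens k U V) t = t.
Proof.
rewrite [RHS]matrix_sum_delta; do 2![apply: eq_bigr => ? _].
by rewrite tens_ibase.
Qed.

Lemma linear_tensor_lift (U V W X : vectType k) (h : {linear W -> X})
    (f : U -> V -> W) t :
  h (tensor_lift f t) = tensor_lift (fun u v => h (f u v)) t.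
Proof.
rewrite linear_sum; apply: eq_bigr => i _; rewrite linear_sum.
by apply: eq_bigr => j _; rewrite linearZ.
Qed.

End TensorTheory.

(** * Hopf algebras *)

Definition tensor_map (k : fieldType) (U V U' V' : vectType k)
    (f : U -> U') (g : V -> V') : tensor U V -> tensor U' V' :=
  tensor_lift (fun u v => f u ⊗ g v).

(** Multiplication of the tensor product algebra:
    [(x1 ⊗ x2) (y1 ⊗ y2) = (x1 * y1) ⊗ (x2 * y2)]. *)
Definition tensor_mul (k : fieldType) (A B : falgType k)
    (s t : tensor A B) : tensor A B :=
  tensor_lift (fun x1 x2 =>
    tensor_lift (fun y1 y2 => (x1 * y1) ⊗ (x2 * y2)) t) s.

(** In sumless Sweedler notation, [tensor_lift (fun x1 x2 => E) (comul x)]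
    is [E] with [x1], [x2] the two components of the coproduct of [x]. *)
HB.mixin Record Falgebra_isHopf (k : fieldType) A of Falgebra k A := {
  comul_subdef : 'Hom(A, tensor A A);
  counit_subdef : 'Hom(A, k^o);
  antipode_subdef : 'End(A);
  comulA_subproof : forall x : A,
    tensor_lift (fun x1 x2 => x1 ⊗ comul_subdef x2) (comul_subdef x) =
    tensor_lift (fun x1 x2 =>
      tensor_lift (fun x11 x12 => x11 ⊗ (x12 ⊗ x2)) (comul_subdef x1)) (comul_subdef x);
  counitl_subproof : forall x : A,
    tensor_lift (fun x1 x2 => (counit_subdef x1 : k) *: x2) (comul_subdef x) = x;
  counitr_subproof : forall x : A,
    tensor_lift (fun x1 x2 => (counit_subdef x2 : k) *: x1) (comul_subdef x) = x;
  comul1_subproof : comul_subdef 1 = 1 ⊗ 1;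
  comulM_subproof : forall x y : A, comul_subdef (x * y) = tensor_mul (comul_subdef x) (comul_subdef y);
  counit1_subproof : counit_subdef 1 = 1;
  counitM_subproof : forall x y : A, counit_subdef (x * y) = counit_subdef x * counit_subdef y;
  antipodel_subproof : forall x : A,
    tensor_lift (fun x1 x2 => antipode_subdef x1 * x2) (comul_subdef x) =
    (counit_subdef x : k) *: 1;
  antipoder_subproof : forall x : A,
    tensor_lift (fun x1 x2 => x1 * antipode_subdef x2) (comul_subdef x) =
    (counit_subdef x : k) *: 1
}.

#[short(type="hopfType")]
HB.structure Definition Hopf (k : fieldType) :=
  { A of Falgebra k A & Falgebra_isHopf k A }.

Section HopfTheory.
Variables (k : fieldType) (A : hopfType k).

Definition comul : 'Hom(A, tensor A A) := @comul_subdef k A.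
Definition counit : 'Hom(A, k^o) := @counit_subdef k A.
Definition antipode : 'End(A) := @antipode_subdef k A.

Lemma comulA : forall x : A,
  tensor_lift (fun x1 x2 => x1 ⊗ comul x2) (comul x) =
  tensor_lift (fun x1 x2 =>
    tensor_lift (fun x11 x12 => x11 ⊗ (x12 ⊗ x2)) (comul x1)) (comul x).
Proof. exact: comulA_subproof. Qed.

Lemma counitl : forall x : A,
  tensor_lift (fun x1 x2 => (counit x1 : k) *: x2) (comul x) = x.
Proof. exact: counitl_subproof. Qed.

Lemma counitr : forall x : A,
  tensor_lift (fun x1 x2 => (counit x2 : k) *: x1) (comul x) = x.
Proof. exact: counitr_subproof. Qed.

Lemma comul1 : comul 1 = 1 ⊗ 1.
Proof. exact: comul1_subproof. Qed.

Lemma comulM : forall x y : A, comul (x * y) = tensor_mul (comul x) (comul y).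
Proof. exact: comulM_subproof. Qed.

Lemma counit1 : counit 1 = 1.
Proof. exact: counit1_subproof. Qed.

Lemma counitM : forall x y : A, counit (x * y) = counit x * counit y.
Proof. exact: counitM_subproof. Qed.

Lemma antipodel : forall x : A,
  tensor_lift (fun x1 x2 => antipode x1 * x2) (comul x) =
  (counit x : k) *: 1.
Proof. exact: antipodel_subproof. Qed.

Lemma antipoder : forall x : A,
  tensor_lift (fun x1 x2 => x1 * antipode x2) (comul x) =
  (counit x : k) *: 1.
Proof. exact: antipoder_subproof. Qed.

End HopfTheory.

Arguments comul {k A}.
Arguments counit {k A}.
Arguments antipode {k A}.

(** * The dual Hopf algebra *)

Section BilinComp.
Variables (k : fieldType) (U V : vectType k).

Lemma bilin_comp (U' V' : vectType k) (W : lmodType k) (f : U -> V -> W)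
    (g : {linear U' -> U}) (h : {linear V' -> V}) :
  bilin f -> bilin (fun x y => f (g x) (h y)).
Proof.
case=> fl fr; split=> [y c x x'|x c y y'] /=; rewrite linearP; first exact: fl.
exact: fr.
Qed.

End BilinComp.

Section TensorLiftSum.
Variables (k : fieldType) (U V : vectType k).

Lemma mul_bilin (A : algType k) : bilin (fun x y : A => x * y).
Proof.
split=> [y c x x'|x c y y']; first by rewrite mulrDl -scalerAl.
by rewrite mulrDr -scalerAr.
Qed.

Lemma mulk_bilin : bilin (fun x y : k^o => x * y : k^o).
Proof. exact: (mul_bilin k^o). Qed.

Lemma evalM_bilin (f : 'Hom(U, k^o)) (g : 'Hom(V, k^o)) :
  bilin (fun x y => f x * g y : k^o).
Proof. exact: bilin_comp mulk_bilin. Qed.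

Lemma tensor_lift_pair (W : vectType k) (f : U -> V -> W) (t : tensor U V) :
  tensor_lift f t =
  \sum_p (t p.1 p.2 : k) *: f (ibase U p.1) (ibase V p.2).
Proof. exact: pair_bigA. Qed.

Lemma tensor_lift_sum (W : vectType k) (I : finType) (F : I -> U -> V -> W) t :
  tensor_lift (fun u v => \sum_i F i u v) t = \sum_i tensor_lift (F i) t.
Proof.
rewrite tensor_lift_pair; under eq_bigr do rewrite scaler_sumr.
by rewrite exchange_big; apply: eq_bigr => i _; rewrite tensor_lift_pair.
Qed.

Lemma tensor_liftP (W : vectType k) c (F G : U -> V -> W) t :
  tensor_lift (fun u v => c *: F u v + G u v) t =
  c *: tensor_lift F t + tensor_lift G t.
Proof.
rewrite !tensor_lift_pair scaler_sumr -big_split; apply: eq_bigr => i _ /=.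
by rewrite scalerDr !scalerA mulrC.
Qed.

End TensorLiftSum.

Section TensorLiftExchange.
Variables (k : fieldType) (U V : vectType k).

Lemma tensor_lift_exch (X Y W : vectType k) (t : tensor U V) (s : tensor X Y)
    (f : U -> V -> X -> Y -> W) :
  tensor_lift (fun u v => tensor_lift (f u v) s) t =
  tensor_lift (fun x y => tensor_lift (fun u v => f u v x y) t) s.
Proof.
rewrite !tensor_lift_pair; under eq_bigr do rewrite tensor_lift_pair scaler_sumr.
rewrite exchange_big; apply: eq_bigr => q _.
rewrite tensor_lift_pair scaler_sumr; apply: eq_bigr => p _.
by rewrite !scalerA mulrC.
Qed.

Lemma tensor_liftMl (c : k) (f : U -> V -> k^o) t :
  c * tensor_lift f t = tensor_lift (fun u v => c * f u v : k^o) t.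
Proof.
rewrite /tensor_lift mulr_sumr; apply: eq_bigr => i _; rewrite mulr_sumr.
by apply: eq_bigr => j _; rewrite mulrCA.
Qed.

Lemma tensor_liftMr (c : k) (f : U -> V -> k^o) t :
  tensor_lift f t * c = tensor_lift (fun u v => f u v * c : k^o) t.
Proof.
rewrite mulrC tensor_liftMl; apply: eq_tensor_lift => u v; exact: mulrC.
Qed.

End TensorLiftExchange.

Definition dual (k : fieldType) (V : vectType k) : Type := 'Hom(V, k^o).
HB.instance Definition _ (k : fieldType) (V : vectType k) :=
  Vector.on (dual V).

Section DualSpace.
Variables (k : fieldType) (V : vectType k).

Definition idual (i : 'I_(dim V)) : dual V := linfun (fun v => v2r v 0 i : k^o).

Lemma idualE i v : idual i v = v2r v 0 i.
Proof.
have L : linear (fun v => v2r v 0 i : k^o).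
  by move=> c x y; rewrite linearP !mxE.
pose fL : {linear V -> k^o} :=
  HB.pack (fun v => v2r v 0 i : k^o) (GRing.isLinear.Build k V k^o *:%R _ L).
by rewrite /idual (lfunE fL).
Qed.

Lemma idual_sum (f : dual V) : f = \sum_i (f (ibase V i) : k) *: idual i.
Proof.
apply/lfunP => v; rewrite [in LHS](ibase_sum v) linear_sum sum_lfunE.
apply: eq_bigr => i _; rewrite linearZ scale_lfunE /= idualE.
exact: mulrC.
Qed.

(** Every linear functional on the dual is an evaluation. *)
Lemma dual_reflexive (h : dual (dual V)) :
  exists v : V, forall f : dual V, h f = f v.
Proof.
exists (\sum_i (h (idual i) : k) *: ibase V i) => f.
rewrite [in LHS](idual_sum f) !linear_sum; apply: eq_bigr => i _.
by rewrite !linearZ /=; exact: mulrC.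
Qed.

Lemma linear_eval (v : V) : linear (fun f : dual V => f v : k^o).
Proof. by move=> c f g; rewrite add_lfunE scale_lfunE. Qed.

End DualSpace.

Lemma tensor_lift_eval (k : fieldType) (U V W : vectType k)
    (F : U -> V -> dual W) t w :
  tensor_lift F t w = tensor_lift (fun u v => F u v w : k^o) t.
Proof.
rewrite sum_lfunE; apply: eq_bigr => i _; rewrite sum_lfunE.
by apply: eq_bigr => j _; rewrite scale_lfunE.
Qed.

Section Eval.
Variables (k : fieldType) (U V : vectType k).

(** The canonical pairing of [U^* ⊗ V^*] with [U × V]. *)
Definition ev2 (u : U) (v : V) (t : tensor (dual U) (dual V)) : k^o :=
  tensor_lift (fun (f : dual U) (g : dual V) => f u * g v : k^o) t.

HB.instance Definition _ u v := GRing.Linear.copy (ev2 u v)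
  (tensor_lift (fun (f : dual U) (g : dual V) => f u * g v : k^o)).

Lemma ev2_tens u v (f : dual U) (g : dual V) : ev2 u v (f ⊗ g) = f u * g v.
Proof.
rewrite /ev2 tensor_liftE //; split=> [{}g c {f}f f'|{}f c {g}g g'].
  by rewrite add_lfunE scale_lfunE mulrDl -scalerAl.
by rewrite add_lfunE scale_lfunE mulrDr -scalerAr.
Qed.

Lemma tensor_sep (X Y : vectType k) (t t' : tensor X Y) :
  (forall (f : dual X) (g : dual Y),
    tensor_lift (fun x y => f x * g y : k^o) t =
    tensor_lift (fun x y => f x * g y : k^o) t') -> t = t'.
Proof.
move=> tt'; apply/matrixP=> i j.
suff E (s : tensor X Y) :
    tensor_lift (fun x y => idual i x * idual j y : k^o) s = s i j.
  by rewrite -!E tt'.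
rewrite /tensor_lift (bigD1 i) //= [X in _ + X]big1 => [|p pi].
  rewrite addr0 (bigD1 j) //= [X in _ + X]big1 => [|q qj].
    by rewrite addr0 !idualE !r2vK !mxE !eqxx mulr1; exact: mulr1.
  by rewrite !idualE !r2vK !mxE !eqxx [j == q]eq_sym (negPf qj) mulr0 scaler0.
rewrite big1 // => q _.
by rewrite !idualE !r2vK !mxE !eqxx [i == p]eq_sym (negPf pi) mul0r scaler0.
Qed.

Lemma ev2_inj t t' : (forall u v, ev2 u v t = ev2 u v t') -> t = t'.
Proof.
move=> tt'; apply: tensor_sep => f g.
have [u fE] := dual_reflexive f; have [v gE] := dual_reflexive g.
have E s : tensor_lift (fun x y => f x * g y : k^o) s = ev2 u v s.
  by apply: eq_tensor_lift => x y; rewrite fE gE.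
by rewrite !E.
Qed.

End Eval.

Section Eval3.
Variables (k : fieldType) (U V W : vectType k).

Definition ev3 (u : U) (v : V) (w : W)
    (t : tensor (dual U) (tensor (dual V) (dual W))) : k^o :=
  tensor_lift (fun (f : dual U) s => f u * ev2 v w s : k^o) t.

HB.instance Definition _ u v w := GRing.Linear.copy (ev3 u v w)
  (tensor_lift (fun (f : dual U) (s : tensor (dual V) (dual W)) =>
     f u * ev2 v w s : k^o)).

Lemma ev3_tens u v w (f : dual U) s : ev3 u v w (f ⊗ s) = f u * ev2 v w s.
Proof.
rewrite /ev3 tensor_liftE //; split=> [{}s c {f}f f'|{}f c {s}s s'].
  by rewrite add_lfunE scale_lfunE mulrDl -scalerAl.
by rewrite linearP mulrDr -scalerAr.
Qed.

Lemma ev3_inj t t' : (forall u v w, ev3 u v w t = ev3 u v w t') -> t = t'.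
Proof.
move=> tt'; apply: tensor_sep => f g.
have [u fE] := dual_reflexive f.
have coordE i j : exists v w, forall s : tensor (dual V) (dual W), s i j = ev2 v w s.
  have [v vE] := dual_reflexive (idual i).
  have [w wE] := dual_reflexive (idual j).
  exists v, w => s; rewrite -[s in LHS]tensor_id /ev2 /tensor_lift.
  rewrite summxE; apply: eq_bigr => p _; rewrite summxE; apply: eq_bigr => q _.
  rewrite -vE -wE !idualE mxE; congr (_ * _); rewrite mxE big_ord1 !mxE.
  by [].
have /fin_all_exists [v /fin_all_exists [w vwE]] : forall p : 'I__ * 'I__,
    exists v w, forall s : tensor (dual V) (dual W), s p.1 p.2 = ev2 v w s.
  by move=> p; exact: coordE.
pose c p : k := g (ibase _ p.1 ⊗ ibase _ p.2).
have sE s : g s = \sum_p ev2 (v p) (w p) s * c p.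
  rewrite -[s in LHS]tensor_id linear_tensor_lift tensor_lift_pair.
  by apply: eq_bigr => p _; rewrite -vwE.
have E s : tensor_lift (fun x y => f x * g y : k^o) s =
   \sum_p ev3 u (v p) (w p) s * c p.
  under eq_tensor_lift => x y do rewrite sE mulr_sumr.
  rewrite tensor_lift_sum; apply: eq_bigr => p _; rewrite /ev3 tensor_liftMr.
  by apply: eq_tensor_lift => x y; rewrite mulrA fE.
by rewrite !E; apply: eq_bigr => p _; rewrite tt'.
Qed.

End Eval3.

Section DualHopf.
Variables (k : fieldType) (A : hopfType k).
Implicit Types (f g h : dual A) (x y z : A).

Definition dual_one : dual A := counit.

Definition dual_mul f g : dual A :=
  linfun (fun x => tensor_lift (fun x1 x2 => f x1 * g x2 : k^o) (comul x)).

Lemma dual_mulE f g x :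
  dual_mul f g x = tensor_lift (fun x1 x2 => f x1 * g x2 : k^o) (comul x).
Proof.
exact: (lfunE (tensor_lift (fun x1 x2 => f x1 * g x2 : k^o) \o comul)).
Qed.

Fact dual_mulA : associative dual_mul.
Proof.
move=> f g h; apply/lfunP => x; rewrite !dual_mulE.
pose T (a : A) (t : tensor A A) : k^o :=
  f a * tensor_lift (fun a1 a2 => g a1 * h a2 : k^o) t.
have TB : bilin T.
  exact: (bilin_comp f (tensor_lift (fun a1 a2 => g a1 * h a2 : k^o))
    (mulk_bilin k)).
have := congr1 (tensor_lift T) (comulA x).
rewrite !linear_tensor_lift => E.
transitivity (tensor_lift (fun a b => tensor_lift T (a ⊗ comul b)) (comul x)).
  by apply: eq_tensor_lift => a b; rewrite tensor_liftE // dual_mulE.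
rewrite E; apply: eq_tensor_lift => a b.
rewrite linear_tensor_lift dual_mulE tensor_liftMr; apply: eq_tensor_lift => c d.
by rewrite /= tensor_liftE // /T tensor_liftE ?mulrA //; exact: evalM_bilin.
Qed.

Fact dual_mul1l : left_id dual_one dual_mul.
Proof.
move=> f; apply/lfunP => x; rewrite dual_mulE -[in RHS](counitl x).
rewrite linear_tensor_lift; apply: eq_tensor_lift => a b.
by rewrite linearZ.
Qed.

Fact dual_mul1r : right_id dual_one dual_mul.
Proof.
move=> f; apply/lfunP => x; rewrite dual_mulE -[in RHS](counitr x).
rewrite linear_tensor_lift; apply: eq_tensor_lift => a b.
by rewrite linearZ /= mulrC.
Qed.

Fact dual_mul_bilin : bilin dual_mul.
Proof.
split=> [g c f f'|f c g g']; apply/lfunP => x;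
  rewrite add_lfunE scale_lfunE !dual_mulE -tensor_liftP;
  apply: eq_tensor_lift => a b; rewrite add_lfunE scale_lfunE.
  by rewrite mulrDl -scalerAl.
by rewrite mulrDr -scalerAr.
Qed.

Fact dual_mulDl : left_distributive dual_mul +%R.
Proof.
by move=> f g h; have := dual_mul_bilin.1 h 1 f g; rewrite /= !scale1r.
Qed.

Fact dual_mulDr : right_distributive dual_mul +%R.
Proof.
by move=> f g h; have := dual_mul_bilin.2 f 1 g h; rewrite /= !scale1r.
Qed.

Fact dual_one_neq0 : dual_one != 0.
Proof.
apply/eqP => /lfunP/(_ 1); rewrite counit1 zero_lfunE => /eqP.
by rewrite oner_eq0.
Qed.

(** Multiplication is the transpose of [comul] (convolution), and [dual_comul]
    below the transpose of multiplication (see [dual_comulE]). *)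
HB.instance Definition _ := GRing.Zmodule_isNzRing.Build (dual A)
  dual_mulA dual_mul1l dual_mul1r dual_mulDl dual_mulDr dual_one_neq0.

Fact dual_scalerAl (c : k) (f g : dual A) : c *: (f * g) = (c *: f) * g.
Proof.
have := dual_mul_bilin.1 g c f 0; rewrite /= addr0 => E; rewrite [RHS]E.
by rewrite -[dual_mul 0 g]/(0 * g) mul0r addr0.
Qed.

Fact dual_scalerAr (c : k) (f g : dual A) : c *: (f * g) = f * (c *: g).
Proof.
have := dual_mul_bilin.2 f c g 0; rewrite /= addr0 => E; rewrite [RHS]E.
by rewrite -[dual_mul f 0]/(f * 0) mulr0 addr0.
Qed.

HB.instance Definition _ := GRing.Lmodule_isLalgebra.Build k (dual A)
  dual_scalerAl.
HB.instance Definition _ := GRing.Lalgebra_isAlgebra.Build k (dual A)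
  dual_scalerAr.
HB.instance Definition _ := Algebra_isFalgebra.Build k (dual A).

Definition dual_comul : 'Hom(dual A, tensor (dual A) (dual A)) :=
  linfun (fun f => \sum_i \sum_j
    (f (ibase A i * ibase A j) : k) *: (idual i ⊗ idual j)).

Definition dual_counit : 'Hom(dual A, k^o) := linfun (fun f => f 1).

Definition dual_antipode : 'End(dual A) :=
  linfun (fun f => (f \o antipode)%VF).

Lemma dual_comulE f x y : ev2 x y (dual_comul f) = f (x * y).
Proof.
have L : linear (fun f : dual A => \sum_i \sum_j
    (f (ibase A i * ibase A j) : k) *: (idual i ⊗ idual j)).
  move=> c g h; rewrite scaler_sumr -big_split; apply: eq_bigr => i _ /=.
  rewrite scaler_sumr -big_split; apply: eq_bigr => j _ /=.
  by rewrite add_lfunE scale_lfunE scalerDl scalerA.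
pose fL : {linear dual A -> tensor (dual A) (dual A)} :=
  HB.pack (fun f : dual A => \sum_i \sum_j
    (f (ibase A i * ibase A j) : k) *: (idual i ⊗ idual j))
  (GRing.isLinear.Build k _ _ *:%R _ L).
rewrite /dual_comul (lfunE fL) /= linear_sum [x in RHS]ibase_sum.
rewrite (bilin_suml _ _ _ (mul_bilin A)) linear_sum; apply: eq_bigr => i _.
rewrite linear_sum [y in RHS]ibase_sum (bilin_sumr _ _ _ (mul_bilin A)).
rewrite [RHS]linearZ [X in _ = _ *: X]linear_sum [RHS]scaler_sumr; apply: eq_bigr => j _.
rewrite !linearZ /= ev2_tens !idualE.
by rewrite scalerA (mulrC (v2r y 0 j)); exact: mulrC.
Qed.

Lemma dual_counitE f : dual_counit f = f 1.
Proof.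
pose fL : {linear dual A -> k^o} := HB.pack (fun f : dual A => f 1)
  (GRing.isLinear.Build k _ _ *:%R _ (linear_eval 1)).
by rewrite /dual_counit (lfunE fL).
Qed.

Lemma dual_antipodeE f x : dual_antipode f x = f (antipode x).
Proof.
have L : linear (fun f : dual A => (f \o antipode)%VF : dual A).
  by move=> c g h; rewrite comp_lfunDl comp_lfunZl.
pose fL : {linear dual A -> dual A} :=
  HB.pack (fun f : dual A => (f \o antipode)%VF : dual A)
  (GRing.isLinear.Build k _ _ *:%R _ L).
by rewrite /dual_antipode (lfunE fL) comp_lfunE.
Qed.

Fact dual_comulA f :
  tensor_lift (fun f1 f2 => f1 ⊗ dual_comul f2) (dual_comul f) =
  tensor_lift (fun f1 f2 =>
    tensor_lift (fun f11 f12 => f11 ⊗ (f12 ⊗ f2)) (dual_comul f1))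
    (dual_comul f).
Proof.
apply: ev3_inj => x y z; rewrite !linear_tensor_lift.
transitivity (ev2 x (y * z) (dual_comul f)).
  by apply: eq_tensor_lift => g h; rewrite /= ev3_tens dual_comulE.
rewrite dual_comulE mulrA -dual_comulE; apply: eq_tensor_lift => g h.
rewrite linear_tensor_lift -dual_comulE tensor_liftMr.
by apply: eq_tensor_lift => g1 g2; rewrite /= ev3_tens ev2_tens mulrA.
Qed.

Fact dual_counitl f :
  tensor_lift (fun f1 f2 => (dual_counit f1 : k) *: f2) (dual_comul f) = f.
Proof.
apply/lfunP => x; rewrite -[in RHS](mul1r x) -dual_comulE.
rewrite tensor_lift_eval; apply: eq_tensor_lift => g h.
by rewrite scale_lfunE dual_counitE.
Qed.

Fact dual_counitr f :
  tensor_lift (fun f1 f2 => (dual_counit f2 : k) *: f1) (dual_comul f) = f.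
Proof.
apply/lfunP => x; rewrite -[in RHS](mulr1 x) -dual_comulE.
rewrite tensor_lift_eval; apply: eq_tensor_lift => g h.
by rewrite scale_lfunE dual_counitE; exact: mulrC.
Qed.

Fact dual_comul1 : dual_comul 1 = 1 ⊗ 1.
Proof.
by apply: ev2_inj => x y; rewrite dual_comulE ev2_tens; exact: counitM.
Qed.

Fact dual_comulM f g :
  dual_comul (f * g) = tensor_mul (dual_comul f) (dual_comul g).
Proof.
apply: ev2_inj => x y; rewrite dual_comulE dual_mulE comulM /tensor_mul.
have fgB : bilin (fun x1 x2 => f x1 * g x2 : k^o) by exact: evalM_bilin.
rewrite !linear_tensor_lift.
transitivity (tensor_lift (fun x1 x2 => tensor_lift (fun y1 y2 =>
    f (x1 * y1) * g (x2 * y2) : k^o) (comul y)) (comul x)).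
  apply: eq_tensor_lift => x1 x2; rewrite linear_tensor_lift.
  by apply: eq_tensor_lift => y1 y2; rewrite /= tensor_liftE.
transitivity (tensor_lift (fun f1 f2 => tensor_lift (fun g1 g2 =>
    tensor_lift (fun x1 x2 => tensor_lift (fun y1 y2 =>
      (f1 x1 * g1 x2) * (f2 y1 * g2 y2) : k^o) (comul y)) (comul x))
    (dual_comul g)) (dual_comul f)); last first.
  apply: eq_tensor_lift => f1 f2; rewrite linear_tensor_lift.
  apply: eq_tensor_lift => g1 g2; rewrite /= ev2_tens !dual_mulE.
  rewrite tensor_liftMr; apply: eq_tensor_lift => x1 x2.
  by rewrite tensor_liftMl.
under [RHS]eq_tensor_lift => f1 f2.
  rewrite tensor_lift_exch; over.
rewrite [RHS]tensor_lift_exch; apply: eq_tensor_lift => x1 x2.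
under [RHS]eq_tensor_lift => f1 f2.
  rewrite tensor_lift_exch; over.
rewrite [RHS]tensor_lift_exch; apply: eq_tensor_lift => y1 y2.
rewrite -!dual_comulE /ev2 tensor_liftMr; apply: eq_tensor_lift => f1 f2.
by rewrite tensor_liftMl; apply: eq_tensor_lift => g1 g2; rewrite mulrACA.
Qed.

Fact dual_counit1 : dual_counit 1 = 1.
Proof. by rewrite dual_counitE; exact: counit1. Qed.

Fact dual_counitM f g : dual_counit (f * g) = dual_counit f * dual_counit g.
Proof.
rewrite !dual_counitE dual_mulE comul1 tensor_liftE //; exact: evalM_bilin.
Qed.

Fact dual_antipodel f :
  tensor_lift (fun f1 f2 => dual_antipode f1 * f2) (dual_comul f) =
  (dual_counit f : k) *: 1.
Proof.
apply/lfunP => x; rewrite tensor_lift_eval scale_lfunE dual_counitE.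
transitivity (f (tensor_lift (fun x1 x2 => antipode x1 * x2) (comul x))).
  rewrite linear_tensor_lift.
  under eq_tensor_lift do rewrite dual_mulE.
  rewrite tensor_lift_exch; apply: eq_tensor_lift => x1 x2.
  rewrite /= -dual_comulE; apply: eq_tensor_lift => f1 f2.
  by rewrite dual_antipodeE.
by rewrite antipodel linearZ /=; exact: mulrC.
Qed.

Fact dual_antipoder f :
  tensor_lift (fun f1 f2 => f1 * dual_antipode f2) (dual_comul f) =
  (dual_counit f : k) *: 1.
Proof.
apply/lfunP => x; rewrite tensor_lift_eval scale_lfunE dual_counitE.
transitivity (f (tensor_lift (fun x1 x2 => x1 * antipode x2) (comul x))).
  rewrite linear_tensor_lift.
  under eq_tensor_lift do rewrite dual_mulE.
  rewrite tensor_lift_exch; apply: eq_tensor_lift => x1 x2.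
  rewrite /= -dual_comulE; apply: eq_tensor_lift => f1 f2.
  by rewrite dual_antipodeE.
by rewrite antipoder linearZ /=; exact: mulrC.
Qed.

HB.instance Definition _ := Falgebra_isHopf.Build k (dual A)
  dual_comulA dual_counitl dual_counitr dual_comul1 dual_comulM
  dual_counit1 dual_counitM dual_antipodel dual_antipoder.

End DualHopf.

(** * Isomorphisms and self-duality *)

(** Compatibility with the antipodes is automatic, hence not required. *)
Record hopf_iso (k : fieldType) (A B : hopfType k) (phi : A -> B) : Prop :=
  HopfIso {
    hopf_iso_linear : linear phi;
    hopf_iso_monoid : monoid_morphism phi;
    hopf_iso_comul : forall x, comul (phi x) = tensor_map phi phi (comul x);
    hopf_iso_counit : forall x, counit (phi x) = counit x;
    hopf_iso_bij : bijective phi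
  }.

(** [phi^*], with [phi^*(x)(y) = phi(y)(x)] (see [dual_transposeE]). *)
Definition dual_transpose (k : fieldType) (V : vectType k)
    (phi : V -> dual V) (x : V) : dual V := linfun (fun y => phi y x).

Lemma dual_transposeE (k : fieldType) (V : vectType k) (phi : V -> dual V) x y :
  linear phi -> dual_transpose phi x y = phi y x.
Proof.
move=> phiL; have L : linear (fun y => phi y x : k^o).
  by move=> c v w; rewrite phiL add_lfunE scale_lfunE.
pose fL : {linear V -> k^o} := HB.pack (fun y => phi y x : k^o)
  (GRing.isLinear.Build k _ _ *:%R _ L).
by rewrite /dual_transpose (lfunE fL).
Qed.

Definition sym_self_duality (k : fieldType) (A : hopfType k)
    (phi : A -> dual A) : Prop :=
  hopf_iso phi /\ phi =1 dual_transpose phi.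

(** * Bases and structure constants *)

Section Bases.
Variables (k : fieldType) (I : finType).

Definition is_basis (V : vectType k) (d : I -> V) : bool :=
  basis_of fullv (codom d).

Definition dual_basis (V : vectType k) (d : I -> V) (i : I) : dual V :=
  linfun (fun x => coord (codom_tuple d) (enum_rank i) x : k^o).

(** Structure constants [c i j l] stand for a lower pair of indices [i], [j]
    and an upper index [l]. *)
Definition mul_constants (A : falgType k) (d : I -> A) (F : I -> I -> I -> k) :=
  forall i j, d i * d j = \sum_l F i j l *: d l.

Definition comul_constants (A : hopfType k) (d : I -> A)
    (G : I -> I -> I -> k) :=
  forall l, comul (d l) = \sum_i \sum_j G i j l *: (d i ⊗ d j).

(** The bilinear operation with structure constants [c] on the basis [d]
    (see [mul_of_constantsE]). *)
Definition mul_of_constants (V : vectType k) (d : I -> V)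
    (c : I -> I -> I -> k) (x y : V) : V :=
  \sum_i \sum_j \sum_l
    ((dual_basis d i x : k) * (dual_basis d j y : k) * c i j l) *: d l.

Definition imath_constants (s : I -> I -> k) (G F : I -> I -> I -> k)
    (i j l : I) : k :=
  \sum_y1 \sum_y2 \sum_x \sum_z
    s y1 y2 * G y1 x i * G z y2 j * F x z l.

Lemma dual_basis_coord (V : vectType k) (d : I -> V) i x :
  dual_basis d i x = coord (codom_tuple d) (enum_rank i) x.
Proof.
pose f y : k^o := coord (codom_tuple d) (enum_rank i) y.
have L : linear f by move=> c y z; rewrite /f linearP.
pose fL : {linear V -> k^o} := HB.pack f (GRing.isLinear.Build k _ _ *:%R f L).
exact: (lfunE fL).
Qed.

Lemma dual_basisE (V : vectType k) (d : I -> V) i j :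
  is_basis d -> dual_basis d i (d j) = (i == j)%:R.
Proof.
move=> /basis_free dfree; rewrite dual_basis_coord.
have -> : d j = (codom_tuple d)`_(enum_rank j).
  by rewrite (nth_map j) -?cardE ?ltn_ord // nth_enum_rank.
by rewrite coord_free // eq_sym (inj_eq enum_rank_inj).
Qed.

Lemma basis_sum (V : vectType k) (d : I -> V) x :
  is_basis d -> x = \sum_i (dual_basis d i x : k) *: d i.
Proof.
move=> dB; rewrite [LHS](coord_basis (X := codom_tuple d) dB (memvf x)).
rewrite (reindex _ (onW_bij _ (enum_rank_bij I))); apply: eq_bigr => i _.
by rewrite dual_basis_coord (nth_map i) -?cardE ?ltn_ord // nth_enum_rank.
Qed.

Lemma dual_basis_sum (V : vectType k) (d : I -> V) (f : dual V) :
  is_basis d -> f = \sum_i (f (d i) : k) *: dual_basis d i.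
Proof.
move=> dB; apply/lfunP => x; rewrite [in LHS](basis_sum x dB) linear_sum.
rewrite sum_lfunE; apply: eq_bigr => i _; rewrite linearZ scale_lfunE /=.
exact: mulrC.
Qed.

Lemma mul_of_constantsE (V : vectType k) (d : I -> V) c i j :
  is_basis d -> mul_of_constants d c (d i) (d j) = \sum_l c i j l *: d l.
Proof.
move=> dB; rewrite /mul_of_constants (bigD1 i) //= [X in _ + X]big1; last first.
  move=> p pi; do 2![rewrite big1 // => ? _].
  by rewrite dual_basisE // (negPf pi) !mul0r scale0r.
rewrite addr0 (bigD1 j) //= [X in _ + X]big1; last first.
  move=> q qj; rewrite big1 // => l _.
  by rewrite !dual_basisE // (negPf qj) mulr0 mul0r scale0r.
rewrite addr0; apply: eq_bigr => l _.
by rewrite !dual_basisE // !eqxx !mul1r.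
Qed.

(** The structure constants of the dual Hopf algebra on the dual basis. *)
Lemma dual_basisM (A : hopfType k) (d : I -> A) (G : I -> I -> I -> k) i j :
  is_basis d -> comul_constants d G ->
  dual_basis d i * dual_basis d j = \sum_l G i j l *: dual_basis d l.
Proof.
move=> dB dG; rewrite [LHS](dual_basis_sum _ dB); apply: eq_bigr => l _.
congr (_ *: _); rewrite [LHS]dual_mulE dG linear_sum (bigD1 i) //=.
have E p q : tensor_lift (fun x1 x2 => dual_basis d i x1 * dual_basis d j x2 : k^o)
    (G p q l *: (d p ⊗ d q)) = G p q l * ((i == p)%:R * (j == q)%:R).
  by rewrite linearZ /= tensor_liftE ?dual_basisE //; exact: evalM_bilin.
rewrite [X in _ + X]big1 => [|p pi]; last first.
  rewrite linear_sum big1 // => q _.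
  by rewrite [LHS]E eq_sym (negPf pi) mul0r mulr0.
rewrite addr0 linear_sum (bigD1 j) //= E !eqxx !mulr1 big1 ?addr0 // => q qj.
by rewrite [LHS]E [j == q]eq_sym (negPf qj) !mulr0.
Qed.

Lemma dual_basis_comul (A : hopfType k) (d : I -> A) (F : I -> I -> I -> k) l :
  is_basis d -> mul_constants d F ->
  comul (dual_basis d l) =
  \sum_i \sum_j F i j l *: (dual_basis d i ⊗ dual_basis d j).
Proof.
move=> dB dF; apply: ev2_inj => x y; rewrite [LHS]dual_comulE linear_sum.
rewrite [x in LHS](basis_sum x dB) (bilin_suml _ _ _ (mul_bilin A)) linear_sum.
apply: eq_bigr => i _; rewrite linear_sum [y in LHS](basis_sum y dB).
rewrite (bilin_sumr _ _ _ (mul_bilin A)) [LHS]linearZ [X in _ *: X = _]linear_sum.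
rewrite [LHS]scaler_sumr; apply: eq_bigr => j _; rewrite !linearZ /= ev2_tens.
have -> : dual_basis d l (d i * d j) = F i j l.
  rewrite dF linear_sum (bigD1 l) //= linearZ /= dual_basisE // eqxx.
  rewrite big1 => [|q ql]; first by rewrite addr0; exact: mulr1.
  by rewrite linearZ /= dual_basisE // eq_sym (negPf ql) scaler0.
by rewrite scalerA (mulrC (dual_basis d j y)); exact: mulrC.
Qed.

End Bases.

(* Main.v *)
(** Writing [B x y = phi x y] for the Hopf pairing attached to [phi], the new
    product is, in Sweedler notation, [a ⋄ b = B(a1, b2) a2 b1].  The two pairing
    identities [B(x y, z) = B(x, z1) B(y, z2)] and [B(x, y z) = B(x1, y) B(x2, z)],
    together with the multiplicativity of the coproduct, bring both
    [(a ⋄ b) ⋄ c] and [a ⋄ (b ⋄ c)] to the form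
    [B(a1, b3) B(a2, c2) B(b1, c3) a3 b2 c1]. *)

Require Import Defs.
From HB Require Import structures.
From mathcomp Require Import all_boot all_order all_algebra all_field.

Set Implicit Arguments.
Unset Strict Implicit.
Unset Printing Implicit Defensive.

Import GRing.Theory VectorInternalTheory.
Local Open Scope ring_scope.

(** * Linearity of [tensor_lift] and its values on basis tensors *)

Section TensorLiftLemmas.
Variable k : fieldType.

(** Serves maps such as [paired_mul^~ y], whose linearity is a proved fact rather than a declared
    structure. *)
Lemma tensor_lift_linear_for (U V W X : vectType k) (h : W -> X)
    (f : U -> V -> W) t :
  linear h -> h (tensor_lift f t) = tensor_lift (fun u v => h (f u v)) t.
Proof.
move=> hL; pose H : {linear W -> X} :=
  HB.pack h (GRing.isLinear.Build k W X *:%R h hL).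
exact: (linear_tensor_lift H).
Qed.

Lemma tensor_lift_scalel (U V W : vectType k) (f : U -> V -> k^o) (w : W) t :
  (tensor_lift f t : k) *: w = tensor_lift (fun u v => (f u v : k) *: w) t.
Proof.
apply: (@tensor_lift_linear_for U V k^o W (fun c => (c : k) *: w)) => c x y.
by rewrite scalerDl scalerA.
Qed.

Lemma tensor_lift_scaler (U V W : vectType k) (f : U -> V -> W) (c : k) t :
  c *: tensor_lift f t = tensor_lift (fun u v => c *: f u v) t.
Proof.
apply: (@tensor_lift_linear_for U V W W (fun w => c *: w)) => b x y.
by rewrite scalerDr !scalerA mulrC.
Qed.

Lemma tensor_lift_linear_param (U V W X : vectType k) (F : U -> V -> W -> X) t :
  (forall u v, linear (F u v)) ->
  linear (fun w => tensor_lift (fun u v => F u v w) t).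
Proof.
move=> FL c x y; rewrite -tensor_liftP; apply: eq_tensor_lift => u v.
exact: FL.
Qed.

Lemma tensor_lift_bilin_param (U V W W' X : vectType k)
    (F : U -> V -> W -> W' -> X) t :
  (forall u v, bilin (F u v)) ->
  bilin (fun w w' => tensor_lift (fun u v => F u v w w') t).
Proof.
move=> FB; split=> [w'|w].
  by apply: (tensor_lift_linear_param (F := fun u v => (F u v)^~ w'))
    => u v; exact: (FB u v).1.
by apply: (tensor_lift_linear_param (F := fun u v => F u v w))
  => u v; exact: (FB u v).2.
Qed.

Lemma bilinZl (U V W : vectType k) (f : U -> V -> W) c u v :
  bilin f -> f (c *: u) v = c *: f u v.
Proof.
case=> fl _; pose g := f^~ v; pose gL : {linear U -> W} := HB.pack g
  (GRing.isLinear.Build k U W *:%R g (fl v)).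
exact: (linearZ_LR gL).
Qed.

Lemma bilinZr (U V W : vectType k) (f : U -> V -> W) c u v :
  bilin f -> f u (c *: v) = c *: f u v.
Proof.
case=> _ fr; pose fL : {linear V -> W} := HB.pack (f u)
  (GRing.isLinear.Build k V W *:%R (f u) (fr u)).
exact: (linearZ_LR fL).
Qed.

Lemma eq_tensor_lift_ibase (U V W : vectType k) (f g : U -> V -> W) t :
  (forall i j, f (ibase U i) (ibase V j) = g (ibase U i) (ibase V j)) ->
  tensor_lift f t = tensor_lift g t.
Proof. by move=> fg; do 2![apply: eq_bigr => ? _]; rewrite fg. Qed.

(** A basis tensor is a matrix unit, so one term of the double sum survives, for an arbitrary
    function [f]. *)
Lemma tensor_lift_ibase (U V W : vectType k) (f : U -> V -> W) i j :
  tensor_lift f (ibase U i ⊗ ibase V j) = f (ibase U i) (ibase V j).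
Proof.
rewrite tens_ibase /tensor_lift (bigD1 i) //= [X in _ + X]big1 => [|p pi].
  rewrite addr0 (bigD1 j) //= [X in _ + X]big1 => [|q qj].
    by rewrite addr0 mxE !eqxx scale1r.
  by rewrite mxE (negPf qj) andbF scale0r.
by rewrite big1 // => q _; rewrite mxE (negPf pi) scale0r.
Qed.

End TensorLiftLemmas.

(** * Coassociativity and multiplicativity of the coproduct under a lift *)

Section Coproduct.
Variables (k : fieldType) (A : hopfType k).

(* [T] need not be multilinear, since [tensor_lift] only sees its values on the
   internal bases. *)
Lemma tensor_lift_comulA (W : vectType k) (T : A -> A -> A -> W) (x : A) :
  tensor_lift (fun x1 x2 => tensor_lift (T x1) (comul x2)) (comul x) =
  tensor_lift (fun x1 x2 =>
    tensor_lift (fun x11 x12 => T x11 x12 x2) (comul x1)) (comul x).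
Proof.
pose F (u : A) (t : tensor A A) : W := tensor_lift (T u) t.
(* [F] is linear in [t] but perhaps not in [u]. [F'] is the bilinear map that agrees with it when
   [u] is a basis vector, so that [tensor_liftE] applies and the coassociativity axiom can be pushed
   through [tensor_lift F']. *)
pose F' u t : W := \sum_i (v2r u 0 i : k) *: F (ibase A i) t.
have F'B : bilin F'.
  split=> [t c u u'|u c t t']; rewrite /F' /= scaler_sumr -big_split /=.
    by apply: eq_bigr => i _; rewrite linearP !mxE scalerDl scalerA.
  apply: eq_bigr => i _; rewrite /F linearP /= scalerDr !scalerA.
  by rewrite mulrC.
have F'E i t : F' (ibase A i) t = F (ibase A i) t.
  rewrite /F' (bigD1 i) //= big1 => [|p pi].
    by rewrite addr0 /ibase r2vK mxE !eqxx scale1r.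
  by rewrite /ibase r2vK mxE (negPf pi) scale0r.
have := congr1 (tensor_lift F') (comulA x).
rewrite !linear_tensor_lift => E.
transitivity (tensor_lift (fun a b => tensor_lift F' (a ⊗ comul b)) (comul x)).
  by apply: eq_tensor_lift_ibase => i j; rewrite tensor_liftE // F'E.
rewrite E; apply: eq_tensor_lift_ibase => i j; rewrite linear_tensor_lift.
apply: eq_tensor_lift_ibase => p q.
by rewrite /= tensor_liftE // F'E /F tensor_lift_ibase.
Qed.

Lemma tensor_lift_comulM (W : vectType k) (f : A -> A -> W) (x y : A) :
  bilin f ->
  tensor_lift f (comul (x * y)) =
  tensor_lift (fun x1 x2 =>
    tensor_lift (fun y1 y2 => f (x1 * y1) (x2 * y2)) (comul y)) (comul x).
Proof.
move=> fB; rewrite comulM /tensor_mul linear_tensor_lift.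
apply: eq_tensor_lift => x1 x2; rewrite linear_tensor_lift.
by apply: eq_tensor_lift => y1 y2; rewrite /= tensor_liftE.
Qed.

Lemma tensor_lift_comul_constants (I : finType) (d : I -> A)
    (G : I -> I -> I -> k) (W : vectType k) (f : A -> A -> W) l :
  comul_constants d G -> bilin f ->
  tensor_lift f (comul (d l)) = \sum_i \sum_j G i j l *: f (d i) (d j).
Proof.
move=> dG fB; rewrite dG linear_sum; apply: eq_bigr => i _.
rewrite linear_sum; apply: eq_bigr => j _.
by rewrite linearZ /= tensor_liftE.
Qed.

End Coproduct.

(** * The product attached to a bilinear form [B] *)

Section PairedProduct.
Variables (k : fieldType) (A : hopfType k) (B : A -> A -> k^o).

Definition paired_mul (x y : A) : A :=
  tensor_lift (fun x1 x2 =>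
    tensor_lift (fun y1 y2 => (B x1 y2 : k) *: (x2 * y1)) (comul y)) (comul x).

Hypothesis BB : bilin B.

Lemma paired_mul_inner_bilin1 (u v : A) :
  bilin (fun x1 x2 => (B x1 v : k) *: (x2 * u)).
Proof.
split=> [x2 c x x'|x c y y'].
  by rewrite /= (BB.1 v) /= scalerDl scalerA.
by rewrite /= mulrDl scalerDr -scalerAl !scalerA mulrC.
Qed.

Lemma paired_mul_inner_bilin2 (u v : A) :
  bilin (fun y1 y2 => (B u y2 : k) *: (v * y1)).
Proof.
split=> [y2 c x x'|x c y y'].
  by rewrite /= mulrDr scalerDr -scalerAr !scalerA mulrC.
by rewrite /= (BB.2 u) /= scalerDl scalerA.
Qed.

(** Each argument enters only through its coproduct, and [comul] and [tensor_lift] are linear. *)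
Lemma paired_mul_bilin : bilin paired_mul.
Proof.
split=> [y|x].
  move=> c x x'; rewrite /paired_mul; pose f x1 x2 :=
    tensor_lift (fun y1 y2 => (B x1 y2 : k) *: (x2 * y1)) (comul y).
  by rewrite -/f linearP; exact: (linearP (tensor_lift f)).
apply: (tensor_lift_linear_param (F := fun x1 x2 y =>
  tensor_lift (fun y1 y2 => (B x1 y2 : k) *: (x2 * y1)) (comul y))) => u v.
move=> c y y'; rewrite linearP; exact: linearP.
Qed.

Lemma paired_mul_suml (y : A) (U V : vectType k) (f : U -> V -> A) t :
  paired_mul (tensor_lift f t) y =
  tensor_lift (fun u v => paired_mul (f u v) y) t.
Proof.
by apply: (tensor_lift_linear_for (h := paired_mul^~ y)); exact: paired_mul_bilin.1.
Qed.

Lemma paired_mul_sumr (x : A) (U V : vectType k) (f : U -> V -> A) t :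
  paired_mul x (tensor_lift f t) =
  tensor_lift (fun u v => paired_mul x (f u v)) t.
Proof. apply: tensor_lift_linear_for; exact: paired_mul_bilin.2. Qed.

(** By bilinearity only basis vectors matter. In [imath_constants], [y1] and [x] index the two legs
    of [comul (d i)], and [z] and [y2] those of [comul (d j)]: [s y1 y2] pairs the outer legs and
    [F x z l] multiplies the inner ones. *)
Lemma paired_mul_constants (I : finType) (d : I -> A) (F G : I -> I -> I -> k)
    (s : I -> I -> k) :
  is_basis d -> mul_constants d F -> comul_constants d G ->
  (forall i j, B (d i) (d j) = s i j) ->
  mul_of_constants d (imath_constants s G F) =2 paired_mul.
Proof.
move=> dB dF dG Bs x y.
rewrite [x in RHS](basis_sum x dB) (bilin_suml _ _ _ paired_mul_bilin).
apply: eq_bigr => i _.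
rewrite [y in RHS](basis_sum y dB) (bilin_sumr _ _ _ paired_mul_bilin).
rewrite scaler_sumr; apply: eq_bigr => j _.
under eq_bigr do rewrite -scalerA; rewrite -scaler_sumr scalerA.
congr (_ *: _); rewrite /paired_mul (tensor_lift_comul_constants _ dG); last first.
  apply: (tensor_lift_bilin_param (F := fun y1 y2 x1 x2 =>
    (B x1 y2 : k) *: (x2 * y1))).
  exact: paired_mul_inner_bilin1.
under [RHS]eq_bigr => y1 _.
  under eq_bigr => z _.
    rewrite (tensor_lift_comul_constants _ dG); last exact: paired_mul_inner_bilin2.
    over.
  over.
rewrite /=.
(* Summing over [l] first turns the constants [F x z l] back into [d x * d z], leaving the four
   indices that the Sweedler side also carries. *)
transitivity (\sum_y1 \sum_y2 \sum_x \sum_z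
    (s y1 y2 * G y1 x i * G z y2 j) *: (d x * d z)).
  under eq_bigr do rewrite /imath_constants scaler_suml.
  rewrite exchange_big; apply: eq_bigr => y1 _.
  under eq_bigr do rewrite scaler_suml.
  rewrite exchange_big; apply: eq_bigr => y2 _.
  under eq_bigr do rewrite scaler_suml.
  rewrite exchange_big; apply: eq_bigr => x' _.
  under eq_bigr do rewrite scaler_suml.
  rewrite exchange_big; apply: eq_bigr => z _.
  by rewrite dF scaler_sumr; apply: eq_bigr => l _; rewrite scalerA.
apply: eq_bigr => y1 _; rewrite exchange_big; apply: eq_bigr => x' _.
rewrite scaler_sumr exchange_big; apply: eq_bigr => z _.
rewrite scaler_sumr; apply: eq_bigr => y2 _.
by rewrite Bs !scalerA; congr (_ *: _); rewrite mulrC !mulrA mulrC mulrA mulrAC.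
Qed.

(** * Unit and associativity from the pairing identities *)

Hypothesis B1l : forall z, B 1 z = counit z.
Hypothesis B1r : forall x, B x 1 = counit x.
Hypothesis BMl : forall x y z,
  B (x * y) z = tensor_lift (fun z1 z2 => B x z1 * B y z2 : k^o) (comul z).
Hypothesis BMr : forall x y z,
  B x (y * z) = tensor_lift (fun x1 x2 => B x1 y * B x2 z : k^o) (comul x).

(** [comul 1] is a pure tensor, so [B1l] turns the scalar into [counit y2] and the counit axiom
    recovers [y]. *)
Lemma paired_mul1l : left_id 1 paired_mul.
Proof.
move=> y; rewrite /paired_mul comul1 tensor_liftE; last first.
  apply: (tensor_lift_bilin_param (F := fun y1 y2 x1 x2 =>
    (B x1 y2 : k) *: (x2 * y1))).
  exact: paired_mul_inner_bilin1.
rewrite -[RHS]counitr; apply: eq_tensor_lift => y1 y2.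
by rewrite B1l mul1r.
Qed.

Lemma paired_mul1r : right_id 1 paired_mul.
Proof.
move=> x; rewrite /paired_mul comul1 -[RHS]counitl.
apply: eq_tensor_lift => x1 x2; rewrite tensor_liftE ?B1r ?mulr1 //.
exact: paired_mul_inner_bilin2.
Qed.

(** The leg of [c] that is paired is the second one, [c']; [BMl] splits it, so the iterated
    coproduct of [c] is bracketed on the right. *)
Lemma paired_mulMl x y c :
  paired_mul (x * y) c =
  tensor_lift (fun x1 x2 => tensor_lift (fun y1 y2 =>
    tensor_lift (fun c1 c' => tensor_lift (fun c2 c3 =>
      (B x1 c2 * B y1 c3 : k) *: (x2 * y2 * c1))
    (comul c')) (comul c)) (comul y)) (comul x).
Proof.
rewrite /paired_mul tensor_lift_comulM; last first.
  apply: (tensor_lift_bilin_param (F := fun c1 c' x1 x2 =>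
    (B x1 c' : k) *: (x2 * c1))).
  exact: paired_mul_inner_bilin1.
apply: eq_tensor_lift => x1 x2; apply: eq_tensor_lift => y1 y2.
apply: eq_tensor_lift => c1 c'.
by rewrite BMl tensor_lift_scalel.
Qed.

(** Here the paired leg of [a] is the first one, [a'], so [BMr] brackets the iterated coproduct on
    the left. *)
Lemma paired_mulMr a y z :
  paired_mul a (y * z) =
  tensor_lift (fun a' a3 => tensor_lift (fun a1 a2 =>
    tensor_lift (fun y1 y2 => tensor_lift (fun z1 z2 =>
      (B a1 y2 * B a2 z2 : k) *: (a3 * y1 * z1))
    (comul z)) (comul y)) (comul a')) (comul a).
Proof.
apply: eq_tensor_lift => a' a3.
rewrite tensor_lift_comulM; last exact: paired_mul_inner_bilin2.
rewrite [RHS]tensor_lift_exch; apply: eq_tensor_lift => y1 y2.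
rewrite [RHS]tensor_lift_exch; apply: eq_tensor_lift => z1 z2.
by rewrite BMr tensor_lift_scalel; apply: eq_tensor_lift => a1 a2; rewrite mulrA.
Qed.

Definition paired_mul3 (a1 a2 a3 b1 b2 b3 c1 c2 c3 : A) : A :=
  (B a1 b3 * B a2 c2 * B b1 c3 : k) *: (a3 * b2 * c1).

(** Normal form for triple products: every iterated coproduct splits its second leg again, and the
    sums run in the order [a], [b], [c]. *)
Definition paired_mul3_lift (a b c : A) : A :=
  tensor_lift (fun a1 a' => tensor_lift (fun a2 a3 =>
  tensor_lift (fun b1 b' => tensor_lift (fun b2 b3 =>
  tensor_lift (fun c1 c' => tensor_lift (fun c2 c3 =>
    paired_mul3 a1 a2 a3 b1 b2 b3 c1 c2 c3)
  (comul c')) (comul c)) (comul b')) (comul b)) (comul a')) (comul a).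

(** The coproducts of [a] and [c] arrive bracketed on the right. That of [b] splits its first leg
    again, as [a' * b'] is what meets [c], so coassociativity is applied to [b]. *)
Lemma paired_mulAl a b c :
  paired_mul (paired_mul a b) c = paired_mul3_lift a b c.
Proof.
rewrite [X in paired_mul X _]/paired_mul paired_mul_suml.
apply: eq_tensor_lift => a1 a'; rewrite paired_mul_suml.
transitivity (tensor_lift (fun b' b3 => tensor_lift (fun a2 a3 =>
  tensor_lift (fun b1 b2 =>
  tensor_lift (fun c1 c' => tensor_lift (fun c2 c3 =>
    paired_mul3 a1 a2 a3 b1 b2 b3 c1 c2 c3)
  (comul c')) (comul c)) (comul b')) (comul a')) (comul b)).
  apply: eq_tensor_lift => b' b3; rewrite (bilinZl _ _ _ paired_mul_bilin).
  rewrite paired_mulMl.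
  do 4![rewrite tensor_lift_scaler; apply: eq_tensor_lift => ? ?].
  by rewrite scalerA mulrA.
rewrite tensor_lift_exch; apply: eq_tensor_lift => a2 a3.
symmetry; exact: (tensor_lift_comulA (fun b1 b2 b3 =>
  tensor_lift (fun c1 c' => tensor_lift (fun c2 c3 =>
    paired_mul3 a1 a2 a3 b1 b2 b3 c1 c2 c3) (comul c')) (comul c))).
Qed.

(** The roles are complementary: [b] arrives in normal form, while [a] and [c] split their first
    legs again and call for coassociativity. *)
Lemma paired_mulAr a b c :
  paired_mul a (paired_mul b c) = paired_mul3_lift a b c.
Proof.
transitivity (tensor_lift (fun b1 b' => tensor_lift (fun c' c3 =>
  tensor_lift (fun a' a3 => tensor_lift (fun a1 a2 =>
  tensor_lift (fun b2 b3 => tensor_lift (fun c1 c2 =>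
    paired_mul3 a1 a2 a3 b1 b2 b3 c1 c2 c3)
  (comul c')) (comul b')) (comul a')) (comul a)) (comul c)) (comul b)).
  rewrite [X in paired_mul _ X]/paired_mul paired_mul_sumr.
  apply: eq_tensor_lift => b1 b'; rewrite paired_mul_sumr.
  apply: eq_tensor_lift => c' c3; rewrite (bilinZr _ _ _ paired_mul_bilin).
  rewrite paired_mulMr.
  do 4![rewrite tensor_lift_scaler; apply: eq_tensor_lift => ? ?].
  by rewrite scalerA mulrC.
rewrite /paired_mul3_lift (tensor_lift_comulA (fun a1 a2 a3 =>
  tensor_lift (fun b1 b' => tensor_lift (fun b2 b3 =>
  tensor_lift (fun c1 c' => tensor_lift (fun c2 c3 =>
    paired_mul3 a1 a2 a3 b1 b2 b3 c1 c2 c3)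
  (comul c')) (comul c)) (comul b')) (comul b))).
(* The sums start with [b], [c] and then the two coproducts from [a]; each of the latter is moved
   out past [c] and then past [b]. *)
under eq_tensor_lift => b1 b' do rewrite tensor_lift_exch.
rewrite tensor_lift_exch; apply: eq_tensor_lift => a' a3.
under eq_tensor_lift => b1 b' do rewrite tensor_lift_exch.
rewrite tensor_lift_exch; apply: eq_tensor_lift => a1 a2.
apply: eq_tensor_lift => b1 b'.
rewrite tensor_lift_exch; apply: eq_tensor_lift => b2 b3.
by rewrite (tensor_lift_comulA (fun c1 c2 c3 =>
  paired_mul3 a1 a2 a3 b1 b2 b3 c1 c2 c3)).
Qed.

Lemma paired_mulA : associative paired_mul.
Proof. by move=> a b c; rewrite paired_mulAl paired_mulAr. Qed.

End PairedProduct.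

(** * The Hopf pairing of an isomorphism onto the dual *)

Section HopfPairing.
Variables (k : fieldType) (A : hopfType k) (phi : A -> dual A).
Hypothesis phiH : hopf_iso phi.

Let B (x y : A) : k^o := phi x y.

Lemma hopf_pairing_bilin : bilin B.
Proof.
split=> [y c x x'|x]; last exact: linearP.
by rewrite /B (hopf_iso_linear phiH) add_lfunE scale_lfunE.
Qed.

Lemma hopf_pairing1l z : B 1 z = counit z.
Proof. by rewrite /B (hopf_iso_monoid phiH).1. Qed.

(** The counit of [dual A] is evaluation at 1, and [phi] preserves counits. *)
Lemma hopf_pairing1r x : B x 1 = counit x.
Proof. by rewrite -(hopf_iso_counit phiH) [RHS]dual_counitE. Qed.

(** [phi] is multiplicative and the product of [dual A] is convolution. *)
Lemma hopf_pairingMl x y z :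
  B (x * y) z = tensor_lift (fun z1 z2 => B x z1 * B y z2 : k^o) (comul z).
Proof. by rewrite /B (hopf_iso_monoid phiH).2 [LHS]dual_mulE. Qed.

(** The coproduct of [dual A] is the transpose of multiplication, and [phi] respects coproducts. *)
Lemma hopf_pairingMr x y z :
  B x (y * z) = tensor_lift (fun x1 x2 => B x1 y * B x2 z : k^o) (comul x).
Proof.
transitivity (ev2 y z (comul (phi x))); first by rewrite [RHS]dual_comulE.
rewrite (hopf_iso_comul phiH) linear_tensor_lift; apply: eq_tensor_lift => x1 x2.
exact: ev2_tens.
Qed.

End HopfPairing.

(** * The product [dia] as a paired product *)

Theorem theorem4p4 (k : fieldType) (A : hopfType k) (I : finType)
    (d : I -> A) (F G : I -> I -> I -> k) (phi : A -> dual A)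
    (s : I -> I -> k) :
  is_basis d ->
  mul_constants d F ->
  comul_constants d G ->
  sym_self_duality phi ->
  (forall i, phi (d i) = \sum_j s j i *: dual_basis d j) ->
  let dia := mul_of_constants d (imath_constants s G F) in
  [/\ bilinear_for *:%R *:%R dia,
      associative dia,
      left_id (1%:A : A) dia
    & right_id (1%:A : A) dia].
Proof.
move=> dB dF dG [phiH phiT] phis dia.
pose B (x y : A) : k^o := phi x y.
have BB : bilin B := hopf_pairing_bilin phiH.
have phisE i j : phi (d i) (d j) = s j i.
  rewrite phis sum_lfunE (bigD1 j) //= big1 => [|p pj].
    by rewrite addr0 scale_lfunE dual_basisE // eqxx; exact: mulr1.
  by rewrite scale_lfunE dual_basisE // (negPf pj) scaler0.
(* Evaluating [phi (d i)] at [d j] gives the transposed entry [s j i], whereas [imath_constants]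
   pairs through [s i j]; the symmetry [phiT] exchanges the two. *)
have Bs i j : B (d i) (d j) = s i j.
  by rewrite /B phiT dual_transposeE ?phisE //; exact: hopf_iso_linear phiH.
have E : dia =2 paired_mul B by exact: paired_mul_constants.
have one_l := paired_mul1l BB (hopf_pairing1l phiH).
have one_r := paired_mul1r BB (hopf_pairing1r phiH).
have assoc := paired_mulA BB (hopf_pairingMl phiH) (hopf_pairingMr phiH).
have [diaL diaR] := paired_mul_bilin B.
rewrite scale1r; split=> [|x y z|x|x]; rewrite ?E.
- by split=> [y c x x'|x c y y'] /=; rewrite !E; [apply: diaL | apply: diaR].
- exact: assoc.
- exact: one_l.
- exact: one_r.
Qed.
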